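(* Let $X$ be a complex Banach space and let $T \in L(X)$. Then the following properties are equivalent: (1) $T$ is a weak B-Fredholm operator. (2) $T$ is both a left weak semi-B-Fredholm operator and a right weak semi-B-Fredholm operator.
   Context: $L(X)$ is the Banach algebra of bounded linear operators on $X$, $K(X)$ is the closed ideal of compact operators, $\mathcal{C}(X) = L(X)/K(X)$ is the Calkin algebra, and $\Pi : L(X) \to \mathcal{C}(X)$ is the natural projection. An element $a$ of a semigroup (in particular, of an algebra under multiplication) is Drazin invertible if there exists an element $b$ such that $ab = ba$, $b = ab^2$ and $a^k = a^{k+1}b$ for some nonnegative integer $k$. Let $A$ be a ring with unit and $p \in A$ an idempotent; put $C_p = \{x \in A : xp = px\}$. An element $a \in A$ is left (respectively right) $p$-invertible if $ap = pa$ and $a + p$ is left (respectively right) invertible in $C_p$ (i.e. the one-sided inverse can be chosen in $C_p$). An element $a$ of a unital Banach algebra $A$ is left Drazin invertible (respectively right Drazin invertible) if there exists an idempotent $p \in A$ such that $a$ is left $p$-invertible (respectively right $p$-invertible) and $ap$ is nilpotent. $T \in L(X)$ is a weak B-Fredholm operator (respectively left weak semi-B-Fredholm operator, right weak semi-B-Fredholm operator) if $\Pi(T)$ is Drazin invertible (respectively left Drazin invertible, right Drazin invertible) in $\mathcal{C}(X)$. In the left and right definitions the idempotents are not required to coincide. *)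

(* Defs.v *)
From HB Require Import structures.
From mathcomp Require Import all_boot all_order all_algebra.
From mathcomp Require Import all_classical all_reals all_analysis.
From mathcomp Require Export complex.

Set Implicit Arguments.
Unset Strict Implicit.
Unset Printing Implicit Defensive.

Import Order.TTheory GRing.Theory Num.Theory.
Import numFieldNormedType.Exports.

Local Open Scope classical_set_scope.
Local Open Scope ring_scope.

(* Rings are [pzRingType]: the Calkin algebra of a finite-dimensional space is
   the zero ring, which [nzRingType], hence also [algType], excludes.  The
   algebra structures below are therefore given by [pzRingType] and [lmodType]
   instances, with the lemmas [*_scaleAl] and [*_scaleAr]. *)
Section DrazinInvertibility.
Context {A : pzRingType}.
Implicit Types a p x : A.

Definition drazin_invertible a :=
  exists b, [/\ a * b = b * a, b = a * b ^+ 2 &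
                exists k : nat, a ^+ k = a ^+ k.+1 * b].

Definition idempotent_elt p := p * p = p.

Definition nilpotent_elt a := exists n : nat, a ^+ n = 0.

Definition commutant p : set A := [set x | x * p = p * x].

Definition left_p_invertible p a :=
  a * p = p * a /\ exists2 x, commutant p x & x * (a + p) = 1.

Definition right_p_invertible p a :=
  a * p = p * a /\ exists2 x, commutant p x & (a + p) * x = 1.

Definition left_drazin_invertible a :=
  exists p, [/\ idempotent_elt p, left_p_invertible p a & nilpotent_elt (a * p)].

Definition right_drazin_invertible a :=
  exists p, [/\ idempotent_elt p, right_p_invertible p a & nilpotent_elt (a * p)].

End DrazinInvertibility.

(* When [K] is [R[i]], the order compares real parts of numbers with the same
   imaginary part, so the inequality forces [M * `|x|] to be real. *)
Definition bounded_linear {K : numFieldType} {X : normedModType K} :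
    {pred X -> X} :=
  fun f => `[< linear f /\ exists M : K, forall x, `|f x| <= M * `|x| >].

Record bounded_op {K : numFieldType} (X : normedModType K) := BoundedOp {
  bounded_op_fun :> X -> X;
  bounded_opP : bounded_op_fun \in bounded_linear }.

Section BoundedOperators.
Context {K : numFieldType} {X : normedModType K}.
Implicit Types f g h : X -> X.

Lemma bounded_linearP f : reflect
  (linear f /\ exists2 M : K, 0 < M & forall x, `|f x| <= M * `|x|)
  (f \in bounded_linear).
Proof.
apply: (iffP (asboolP _)) => -[lf [M]]; last by move=> _ fM; split=> //; exists M.
move=> fM; split=> //; exists (`|M| + 1) => [|x]; first by rewrite ltr_wpDl.
have : 0 <= M * `|x| by exact: le_trans (fM x).
move=> /ger0_norm Mx; apply: (le_trans (fM x)).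
by rewrite -Mx normrM normr_id ler_wpM2r ?lerDl.
Qed.

Lemma bounded_linear_submod : submod_closed (@bounded_linear K X).
Proof.
split=> [|a f g /bounded_linearP[lf [M M0 fM]] /bounded_linearP[lg [N N0 gN]]].
  apply/bounded_linearP; split=> [b x y|]; first by rewrite /= scaler0 addr0.
  by exists 1 => // x; rewrite normr0 mul1r.
apply/bounded_linearP; split=> [b x y|].
  change (a *: f (b *: x + y) + g (b *: x + y) =
          b *: (a *: f x + g x) + (a *: f y + g y)).
  rewrite lf lg !scalerDr !scalerA [b * a]mulrC -!addrA; congr (_ + _).
  by rewrite addrCA.
exists (`|a| * M + N) => [|x]; first by rewrite ltr_wpDl // mulr_ge0 // ltW.
change (`|a *: f x + g x| <= (`|a| * M + N) * `|x|).
rewrite (le_trans (ler_normD _ _)) // mulrDl lerD // normrZ -mulrA.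
by rewrite ler_wpM2l.
Qed.

HB.instance Definition _ := GRing.isSubmodClosed.Build K (X -> X)
  bounded_linear bounded_linear_submod.

HB.instance Definition _ := [isSub for @bounded_op_fun K X].
HB.instance Definition _ := [Choice of bounded_op X by <:].
HB.instance Definition _ := [SubChoice_isSubLmodule of bounded_op X by <:].

Lemma bounded_op_linear (T : bounded_op X) : linear T.
Proof. by have /bounded_linearP[] := bounded_opP T. Qed.

HB.instance Definition _ (T : bounded_op X) :=
  GRing.isLinear.Build K X X _ T (bounded_op_linear T).

Lemma bounded_op_bound (T : bounded_op X) :
  exists2 M : K, 0 < M & forall x, `|T x| <= M * `|x|.
Proof. by have /bounded_linearP[] := bounded_opP T. Qed.

Lemma bounded_op_continuous (T : bounded_op X) : continuous T.
Proof.
apply/linear_bounded_continuous/bounded_funP => r.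
have [M M0 TM] := bounded_op_bound T; exists (M * r) => x xr.
by rewrite (le_trans (TM x)) // ler_wpM2l // ltW.
Qed.

Lemma bounded_linear_id : (id : X -> X) \in bounded_linear.
Proof. by apply/bounded_linearP; split=> //; exists 1 => // x; rewrite mul1r. Qed.

Lemma bounded_linear_comp (S T : bounded_op X) : S \o T \in bounded_linear.
Proof.
apply/bounded_linearP; split=> [a x y|]; first by rewrite /= !linearP.
have [M M0 SM] := bounded_op_bound S; have [N N0 TN] := bounded_op_bound T.
exists (M * N) => [|x /=]; first exact: mulr_gt0.
by rewrite (le_trans (SM _)) // -mulrA ler_wpM2l // ltW.
Qed.

Definition bounded_op_one : bounded_op X := BoundedOp bounded_linear_id.
Definition bounded_op_comp (S T : bounded_op X) : bounded_op X :=
  BoundedOp (bounded_linear_comp S T).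

Lemma bounded_op_eqP (S T : bounded_op X) : S =1 T <-> S = T.
Proof. by split=> [/funext ST|->//]; exact: val_inj. Qed.

Fact bounded_op_compA : associative bounded_op_comp.
Proof. by move=> S T U; exact/bounded_op_eqP. Qed.
Fact bounded_op_comp1o : left_id bounded_op_one bounded_op_comp.
Proof. by move=> S; exact/bounded_op_eqP. Qed.
Fact bounded_op_compo1 : right_id bounded_op_one bounded_op_comp.
Proof. by move=> S; exact/bounded_op_eqP. Qed.
Fact bounded_op_compDl : left_distributive bounded_op_comp +%R.
Proof. by move=> S T U; exact/bounded_op_eqP. Qed.
Fact bounded_op_compDr : right_distributive bounded_op_comp +%R.
Proof. by move=> S T U; apply/bounded_op_eqP => x; exact: linearD. Qed.

HB.instance Definition _ := GRing.Zmodule_isPzRing.Build (bounded_op X)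
  bounded_op_compA bounded_op_comp1o bounded_op_compo1
  bounded_op_compDl bounded_op_compDr.

Lemma bounded_op_scaleAl (a : K) (S T : bounded_op X) :
  a *: (S * T) = (a *: S) * T.
Proof. exact/bounded_op_eqP. Qed.
Lemma bounded_op_scaleAr (a : K) (S T : bounded_op X) :
  a *: (S * T) = S * (a *: T).
Proof. by apply/bounded_op_eqP => x; apply/esym; exact: linearZ. Qed.

End BoundedOperators.

Definition compact_operator {K : numFieldType} {X : normedModType K} :
    {pred bounded_op X} :=
  fun T => `[< precompact (T @` [set x : X | `|x| <= 1]) >].

Section CompactOperators.
Context {K : numFieldType} {X : normedModType K}.
Implicit Types S T : bounded_op X.

Let unit_ball : set X := [set x | `|x| <= 1].

Lemma compact_operatorP T : reflect
  (exists2 C : set X, compact C & T @` unit_ball `<=` C)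
  (T \in compact_operator).
Proof.
apply: (iffP (asboolP _)) => [|[C cC TC]].
  by rewrite precompactE => cT; exists (closure (T @` unit_ball)) => //;
    exact: subset_closure.
exact/(precompact_subset TC)/compact_precompact/cC/norm_hausdorff.
Qed.

Lemma compact_operator_submod : submod_closed (@compact_operator K X).
Proof.
split=> [|a S T /compact_operatorP[C cC SC] /compact_operatorP[D cD TD]].
  apply/compact_operatorP; exists [set 0]; first exact: compact_set1.
  by move=> _ [x _ <-].
apply/compact_operatorP.
exists ((fun z : X * X => a *: z.1 + z.2) @` (C `*` D)).
  apply: continuous_compact; last exact: compact_setX.
  apply: continuous_subspaceT => z.
  by apply: cvgD; [apply: cvgZr; exact: cvg_fst|exact: cvg_snd].
move=> _ [x xB <-]; exists (S x, T x) => //.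
by split; [apply: SC|apply: TD]; exists x.
Qed.

HB.instance Definition _ := GRing.isSubmodClosed.Build K (bounded_op X)
  compact_operator compact_operator_submod.

Lemma compact_operatorMl S T :
  T \in compact_operator -> S * T \in compact_operator.
Proof.
move=> /compact_operatorP[C cC TC]; apply/compact_operatorP; exists (S @` C).
  apply: continuous_compact cC.
  exact/continuous_subspaceT/bounded_op_continuous.
by move=> _ [x xB <-]; exists (T x) => //; apply: TC; exists x.
Qed.

Lemma compact_operatorMr S T :
  S \in compact_operator -> S * T \in compact_operator.
Proof.
move=> /compact_operatorP[C cC SC]; have [M M0 TM] := bounded_op_bound T.
apply/compact_operatorP; exists ( *:%R M @` C).
  exact/(continuous_compact _ cC)/continuous_subspaceT/scaler_continuous.
move=> _ [x xB <-]; exists (S (M^-1 *: T x)).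
  apply: SC; exists (M^-1 *: T x) => //; rewrite /unit_ball /= normrZ.
  rewrite gtr0_norm ?invr_gt0 // ler_pdivrMl // mulr1 (le_trans (TM x)) //.
  by rewrite ger_pMr.
by rewrite linearZ scalerA divff ?gt_eqF // scale1r.
Qed.

End CompactOperators.

Definition calkin {K : numFieldType} (X : normedModType K) :=
  Quotient.quot (@compact_operator K X).

Section Calkin.
Context {K : numFieldType} {X : normedModType K}.

HB.instance Definition _ := GRing.Zmodule.on (calkin X).

Definition calkin_proj (T : bounded_op X) : calkin X := (\pi_(calkin X) T)%qT.

Lemma calkin_proj_eqP (S T : bounded_op X) :
  calkin_proj S = calkin_proj T <-> S - T \in compact_operator.
Proof. by rewrite Quotient.idealrBE; split=> /eqP. Qed.

Definition calkin_one : calkin X := calkin_proj 1.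
Definition calkin_mul (x y : calkin X) : calkin X :=
  calkin_proj (repr x * repr y).
Definition calkin_scale (a : K) (x : calkin X) : calkin X :=
  calkin_proj (a *: repr x).

Lemma calkin_projK x : calkin_proj (repr x) = x.
Proof. exact: reprK. Qed.

Lemma calkin_projB : zmod_morphism calkin_proj.
Proof. by move=> S T; rewrite /calkin_proj !piE. Qed.

HB.instance Definition _ :=
  GRing.isZmodMorphism.Build (bounded_op X) (calkin X) calkin_proj calkin_projB.

Lemma calkin_projM S T :
  calkin_proj (S * T) = calkin_mul (calkin_proj S) (calkin_proj T).
Proof.
apply/calkin_proj_eqP.
set S' := repr _; set T' := repr _.
have -> : S * T - S' * T' = (S - S') * T + S' * (T - T').
  by rewrite mulrBl mulrBr addrA subrK.
rewrite rpredD //.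
  by apply: compact_operatorMr; apply/calkin_proj_eqP; rewrite calkin_projK.
by apply: compact_operatorMl; apply/calkin_proj_eqP; rewrite calkin_projK.
Qed.

Lemma calkin_projZ a S : calkin_proj (a *: S) = calkin_scale a (calkin_proj S).
Proof.
apply/calkin_proj_eqP; rewrite -scalerBr rpredZ //.
by apply/calkin_proj_eqP; rewrite calkin_projK.
Qed.

Lemma calkin_ind (P : calkin X -> Prop) :
  (forall T, P (calkin_proj T)) -> forall x, P x.
Proof. by move=> PT x; rewrite -(calkin_projK x). Qed.

Fact calkin_mulA : associative calkin_mul.
Proof.
by do 3 elim/calkin_ind => ?; rewrite -!calkin_projM mulrA.
Qed.
Fact calkin_mul1r : left_id calkin_one calkin_mul.
Proof. by elim/calkin_ind => T; rewrite -calkin_projM mul1r. Qed.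
Fact calkin_mulr1 : right_id calkin_one calkin_mul.
Proof. by elim/calkin_ind => T; rewrite -calkin_projM mulr1. Qed.
Fact calkin_mulDl : left_distributive calkin_mul +%R.
Proof.
by do 3 elim/calkin_ind => ?; rewrite -raddfD -!calkin_projM mulrDl raddfD.
Qed.
Fact calkin_mulDr : right_distributive calkin_mul +%R.
Proof.
by do 3 elim/calkin_ind => ?; rewrite -raddfD -!calkin_projM mulrDr raddfD.
Qed.

HB.instance Definition _ := GRing.Zmodule_isPzRing.Build (calkin X)
  calkin_mulA calkin_mul1r calkin_mulr1 calkin_mulDl calkin_mulDr.

Fact calkin_scaleA a b x :
  calkin_scale a (calkin_scale b x) = calkin_scale (a * b) x.
Proof. by elim/calkin_ind: x => T; rewrite -!calkin_projZ scalerA. Qed.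
Fact calkin_scale1 : left_id 1 calkin_scale.
Proof. by elim/calkin_ind => T; rewrite -calkin_projZ scale1r. Qed.
Fact calkin_scaleDr : right_distributive calkin_scale +%R.
Proof.
move=> a; do 2 elim/calkin_ind => ?.
by rewrite -raddfD -!calkin_projZ scalerDr raddfD.
Qed.
Fact calkin_scaleDl x : {morph calkin_scale^~ x : a b / a + b}.
Proof.
by move=> a b; elim/calkin_ind: x => T; rewrite -!calkin_projZ scalerDl raddfD.
Qed.

HB.instance Definition _ := GRing.Zmodule_isLmodule.Build K (calkin X)
  calkin_scaleA calkin_scale1 calkin_scaleDr calkin_scaleDl.

Fact calkin_proj_monoid_morphism : monoid_morphism calkin_proj.
Proof. by split=> // S T; exact: calkin_projM. Qed.
HB.instance Definition _ :=
  GRing.isMonoidMorphism.Build (bounded_op X) (calkin X) calkin_proj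
    calkin_proj_monoid_morphism.
HB.instance Definition _ :=
  GRing.isScalable.Build K (bounded_op X) (calkin X) _ calkin_proj calkin_projZ.

Lemma calkin_scaleAl (a : K) (x y : calkin X) : a *: (x * y) = (a *: x) * y.
Proof.
elim/calkin_ind: x => S; elim/calkin_ind: y => T.
by rewrite -rmorphM -!linearZ -rmorphM bounded_op_scaleAl.
Qed.
Lemma calkin_scaleAr (a : K) (x y : calkin X) : a *: (x * y) = x * (a *: y).
Proof.
elim/calkin_ind: x => S; elim/calkin_ind: y => T.
by rewrite -rmorphM -!linearZ -rmorphM bounded_op_scaleAr.
Qed.

Definition weak_B_fredholm (T : bounded_op X) :=
  drazin_invertible (calkin_proj T).
Definition left_weak_semi_B_fredholm (T : bounded_op X) :=
  left_drazin_invertible (calkin_proj T).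
Definition right_weak_semi_B_fredholm (T : bounded_op X) :=
  right_drazin_invertible (calkin_proj T).

End Calkin.

(* Main.v *)
Require Import Defs.
From mathcomp Require Import all_boot all_order all_algebra.
From mathcomp Require Import all_classical all_reals all_analysis.
Import numFieldNormedType.Exports.

(** The equivalence holds in every ring [A]; the theorem is its instance at
    the image of [T] in the Calkin algebra.

    Suppose that [a] is left Drazin invertible with idempotent [p] and right
    Drazin invertible with idempotent [q].  The point is that [p = q].  On the
    corner of [1 - p] the element [a] has a left inverse, hence so has each of
    its powers, and [1 - p] lies in every left ideal [A a^n]
    ([left_p_invertible_dvd]); symmetrically, [1 - q] lies in every right
    ideal [a^n A] ([right_p_invertible_dvd]).  Since a power of [a] kills [p]
    and a power of [a] kills [q] ([nilpotent_corner]), it follows that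
    [(1 - p) q = 0 = p (1 - q)], that is, [q = p q = p].  Now [a + p] has a
    left and a right inverse in the commutant of [p], so they coincide in an
    element [x], and [x (1 - p)] is a Drazin inverse of [a].

    Conversely, if [b] is a Drazin inverse of [a], then [p = 1 - a b] is an
    idempotent, [a p] is nilpotent and [(a + p) (b + p) = 1 + a p] is a unit;
    as [a], [b] and [p] commute, the resulting inverse of [a + p] is two-sided
    and commutes with [p] ([drazin_p_invertible]). *)

Set Implicit Arguments.
Unset Strict Implicit.
Unset Printing Implicit Defensive.

Import GRing.Theory.
Local Open Scope ring_scope.

Section DrazinInvertibilityTheory.
Context {A : pzRingType}.
Implicit Types a b p q : A.

(** The identity [1 - p = x a (1 - p)] can be iterated, since [a] commutes
    with [1 - p]. *)
Lemma left_p_invertible_dvd p a : idempotent_elt p -> left_p_invertible p a ->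
  forall n, exists u, 1 - p = u * a ^+ n.
Proof.
move=> pp [ap [x _ xap]].
have xae : 1 - p = x * (1 - p) * a.
  have pe : p * (1 - p) = 0 by rewrite mulrBr mulr1 pp subrr.
  have ea : (1 - p) * a = a * (1 - p) by rewrite mulrBl mulrBr mul1r mulr1 ap.
  transitivity (x * (a + p) * (1 - p)); first by rewrite xap mul1r.
  by rewrite -!mulrA ea mulrDl pe addr0.
elim=> [|n [u eu]]; first by exists (1 - p); rewrite mulr1.
by exists (x * u); rewrite exprSr mulrA -(mulrA x) -eu.
Qed.

Lemma right_p_invertible_dvd p a : idempotent_elt p -> right_p_invertible p a ->
  forall n, exists u, 1 - p = a ^+ n * u.
Proof.
move=> pp [ap [x _ apx]].
have aex : 1 - p = a * ((1 - p) * x).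
  have ep : (1 - p) * p = 0 by rewrite mulrBl mul1r pp subrr.
  have ea : (1 - p) * a = a * (1 - p) by rewrite mulrBl mulrBr mul1r mulr1 ap.
  transitivity ((1 - p) * ((a + p) * x)); first by rewrite apx mulr1.
  by rewrite !mulrA -ea mulrDr ep addr0.
elim=> [|n [u eu]]; first by exists (1 - p); rewrite mul1r.
by exists (u * x); rewrite exprS -mulrA (mulrA (a ^+ n)) -eu.
Qed.

Lemma idempotentX p n : idempotent_elt p -> p ^+ n.+1 = p.
Proof. by move=> pp; elim: n => [//|n IHn]; rewrite exprS IHn. Qed.

Lemma nilpotent_corner p a : idempotent_elt p -> a * p = p * a ->
  nilpotent_elt (a * p) <-> exists n, a ^+ n * p = 0.
Proof.
move=> pp ap; split=> -[n an0].
  exists n; rewrite -{1}(idempotentX n pp) exprSr mulrA.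
  by rewrite -exprMn_comm // an0 mul0r.
(* The shift of the exponent is for [n = 0], where [(a p)^0 = 1]. *)
by exists n.+1; rewrite exprMn_comm // (idempotentX n pp) exprS -mulrA an0 mulr0.
Qed.

(** [1 - p] is left divisible and [1 - q] right divisible by every power of
    [a], while some power of [a] kills both idempotents. *)
Lemma left_right_drazin_idempotent a p q :
  idempotent_elt p -> left_p_invertible p a -> nilpotent_elt (a * p) ->
  idempotent_elt q -> right_p_invertible q a -> nilpotent_elt (a * q) ->
  p = q.
Proof.
move=> pp lp np qq rq nq.
have [[ap _] [aq _]] := (lp, rq).
have [[n an0] [m am0]] : (exists n, a ^+ n * p = 0) /\ (exists m, a ^+ m * q = 0).
  by split; apply/nilpotent_corner.
have [[u eu] [v fv]] := (left_p_invertible_dvd pp lp m,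
                         right_p_invertible_dvd qq rq n).
have pan : p * a ^+ n = a ^+ n * p by apply: commrX.
have eq0 : (1 - p) * q = 0 by rewrite eu -mulrA am0 mulr0.
have pf0 : p * (1 - q) = 0 by rewrite fv mulrA pan an0 mul0r.
move: eq0 pf0; rewrite mulrBl mulrBr mul1r mulr1.
by move=> /subr0_eq qpq /subr0_eq ppq; rewrite ppq -qpq.
Qed.

Lemma left_right_drazin_invertible a :
  left_drazin_invertible a -> right_drazin_invertible a -> drazin_invertible a.
Proof.
move=> [p [pp lp np]] [q [qq rq nq]].
have qp : q = p := esym (left_right_drazin_idempotent pp lp np qq rq nq).
subst q.
have [ap [x xp xap]] := lp; have [_ [y _ apy]] := rq.
have xy : x = y by rewrite -[x]mulr1 -apy mulrA xap mul1r.
subst y.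
have [n an0] : exists n, a ^+ n * p = 0 by apply/nilpotent_corner.
have pe : p * (1 - p) = 0 by rewrite mulrBr mulr1 pp subrr.
have ea : (1 - p) * a = a * (1 - p) by rewrite mulrBl mulrBr mul1r mulr1 ap.
have ex : (1 - p) * x = x * (1 - p).
  by rewrite mulrBl mulrBr mul1r mulr1 (xp : x * p = p * x).
have ep : (1 - p) * p = 0 by rewrite mulrBl mul1r pp subrr.
have ee : (1 - p) * (1 - p) = 1 - p by rewrite mulrBr ep mulr1 subr0.
have axe : a * (x * (1 - p)) = 1 - p.
  transitivity ((1 - p) * ((a + p) * x)); last by rewrite apy mulr1.
  by rewrite -ex !mulrA -ea mulrDr ep addr0.
have xea : x * (1 - p) * a = 1 - p.
  transitivity (x * (a + p) * (1 - p)); last by rewrite xap mul1r.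
  by rewrite -!mulrA ea mulrDl pe addr0.
exists (x * (1 - p)); split; first by rewrite axe xea.
- by rewrite expr2 mulrA axe mulrA ex -mulrA ee.
- by exists n; rewrite exprSr -mulrA axe mulrBr an0 mulr1 subr0.
Qed.

(** [w] is the Neumann series, which is finite here; being a polynomial in [c],
    it commutes with whatever commutes with [c]. *)
Lemma unipotent_inverse (c : A) : nilpotent_elt c ->
  exists2 w, (1 + c) * w = 1 & forall d, GRing.comm d c -> GRing.comm d w.
Proof.
move=> [n cn0]; exists (\sum_(i < n) (- c) ^+ i).
  have := subrX1 (- c) n; rewrite exprNn cn0 mulr0 sub0r => /(congr1 -%R).
  by rewrite opprK -mulNr opprB opprK.
by move=> d dc; apply: commr_sum => i _; apply/commrX/commrN.
Qed.

(** The inverse of [a + p] is [b] on the corner of [1 - p = a b]; on the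
    corner of [p] it inverts [p + a p], [a p] being nilpotent. *)
Lemma drazin_p_invertible a : drazin_invertible a -> exists p,
  [/\ idempotent_elt p, left_p_invertible p a, right_p_invertible p a &
      nilpotent_elt (a * p)].
Proof.
move=> [b [ab bab [k ak]]].
have [p pE] : exists p, p = 1 - a * b by exists (1 - a * b).
have cab : GRing.comm a b := ab.
have cap : GRing.comm a p.
  by rewrite pE; apply: commrB; [exact: commr1|exact: commrM].
have cbp : GRing.comm b p.
  rewrite pE; apply: commrB; first exact: commr1.
  by apply: commrM => //; exact: commr_sym.
have pb0 : p * b = 0 by rewrite pE mulrBl mul1r -mulrA -expr2 -bab subrr.
have pp : p * p = p.
  by rewrite {2}pE mulrBr mulr1 mulrA -cap -mulrA pb0 mulr0 subr0.
have np : nilpotent_elt (a * p).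
  by apply/nilpotent_corner => //; exists k;
     rewrite pE mulrBr mulr1 mulrA -exprSr -ak subrr.
have [w apw cw] := unipotent_inverse np.
have cpap : GRing.comm p (a * p) by apply: commrM; [exact: commr_sym|].
have caap : GRing.comm a (a * p) by apply: commrM.
have apbp : (a + p) * (b + p) = 1 + a * p.
  by rewrite mulrDl !mulrDr pb0 pp add0r addrAC {1}pE subrKC.
pose x := (b + p) * w.
have apx : (a + p) * x = 1 by rewrite mulrA apbp.
have cpx : GRing.comm p x.
  by apply: commrM; [apply: commrD => //; exact: commr_sym|exact: cw].
have cax : GRing.comm a x by apply: commrM; [exact: commrD|exact: cw].
have xap : x * (a + p) = 1 by rewrite mulrDr -cax -cpx -mulrDl.
by exists p; split=> //; split=> //; exists x => //; exact/esym.
Qed.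

Lemma drazin_invertible_left_right a :
  drazin_invertible a <-> left_drazin_invertible a /\ right_drazin_invertible a.
Proof.
split=> [/drazin_p_invertible[p [pp lp rp np]]|[]].
  by split; exists p.
exact: left_right_drazin_invertible.
Qed.

End DrazinInvertibilityTheory.

Theorem theorem4p8 (R : realType) (X : completeNormedModType (complex R))
  (T : bounded_op X) :
  weak_B_fredholm T <->
  left_weak_semi_B_fredholm T /\ right_weak_semi_B_fredholm T.
Proof. exact: drazin_invertible_left_right. Qed.
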